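(* Let $n$ be a positive integer such that every component of $4n+1$ is congruent to $1$ modulo $4$. Then there exist a subgroup $J$ of order $2$ of $D\times\{0\}$ and a $J$-resolvable $(D\times V_{4n+1},D\times\{0\},3,1)$ difference family admitting a group of strong multipliers whose order is the greatest odd divisor of $\psi(4n+1)$.
   Context: A component of an integer is a maximal prime power dividing it. For an integer $N>1$ with components $q_1,\dots,q_\omega$, $\mathbb F_N$ denotes the ring $\mathbb F_{q_1}\times\dots\times\mathbb F_{q_\omega}$, $V_N$ its additive group, and $\psi(N)=\prod_i(q_i-1)$ the order of its unit group. $D$ is the group on $\mathbb Z_2\times\mathbb Z_3$ with $(a,b)+(c,d)=(a+c,(-1)^cb+d)$. Groups are written additively, $x-y:=x+(-y)$. For a subgroup $H$ of $G$, a $(G,H,3,1)$ difference family is a family $\mathcal F$ of $3$-subsets of $G$ such that the multiset of differences $x-y$ over ordered pairs of distinct elements in a common block equals $G\setminus H$ (each element once); for $J\le H$ of order $2$, $\mathcal F$ is $J$-resolvable if the multiset union of its blocks is a complete system of representatives for the left cosets $g+J$ of $J$ not contained in $H$. A strong multiplier of $\mathcal F$ is an automorphism of $G$ fixing $H$ elementwise and mapping the set of blocks of $\mathcal F$ onto itself. *)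

(* Defs.v *)
From HB Require Import structures.
From mathcomp Require Import all_boot all_order all_fingroup all_algebra.
From mathcomp Require Import all_solvable all_field.

Set Implicit Arguments.
Unset Strict Implicit.
Unset Printing Implicit Defensive.

Import GroupScope GRing.Theory.

Definition components (N : nat) : seq nat := [seq (p ^ logn p N)%N | p <- primes N].

Definition psi (N : nat) : nat := (\prod_(q <- components N) (q - 1))%N.

Definition greatest_odd_divisor (m : nat) : nat :=
  (\max_(d <- divisors m | odd d) d)%N.

(* The components of N are indexed by its prime divisors. *)
Section ComponentField.

Variables (N : nat) (p : seq_sub (primes N)).

Lemma component_prime : prime (val p).
Proof. by have := valP p; rewrite mem_primes; case/andP. Qed.

Lemma component_exponent_gt0 : (0 < logn (val p) N)%N.
Proof. by rewrite logn_gt0; exact: valP. Qed.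

Definition component_field : finFieldType :=
  s2val (pPrimePowerField component_prime component_exponent_gt0).

Lemma card_component_field : #|component_field| = (val p ^ logn (val p) N)%N.
Proof. by rewrite /component_field; case: pPrimePowerField. Qed.

End ComponentField.

(* The additive group of the product ring of the component fields: the group
   law on finite dependent functions is componentwise, and the group law of a
   finite field F, seen as a finGroupType, is the addition of F. *)
Definition V (N : nat) : finGroupType :=
  {dffun forall p : seq_sub (primes N), (component_field p : finGroupType)}.

(* A type of its own, as 'Z_2 * 'Z_3 is already equipped with the direct
   product law. *)
Definition D : Type := ('Z_2 * 'Z_3)%type.

HB.instance Definition _ := Finite.copy D ('Z_2 * 'Z_3)%type.

Definition D_add (x y : D) : D :=
  (x.1 + y.1, (-1) ^+ (y.1 : nat) * x.2 + y.2)%R.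

Definition D_zero : D := (0, 0)%R.

Definition D_opp (x : D) : D := (- x.1, - ((-1) ^+ (x.1 : nat) * x.2))%R.

Lemma Z2_cases (a : 'Z_2) : a = 0%R \/ a = 1%R.
Proof. by case: a => [[|[|[]]] //] i; [left | right]; apply: val_inj. Qed.

Lemma D_addA : associative D_add.
Proof.
move=> [a b] [c d] [e f]; rewrite /D_add /= !addrA; congr pair.
rewrite mulrDr mulrA; congr (_ * b + _ + _)%R.
by case: (Z2_cases c) => ->; case: (Z2_cases e) => ->; apply: val_inj.
Qed.

Lemma D_add0 : left_id D_zero D_add.
Proof. by move=> [a b]; rewrite /D_add /= mulr0 !add0r. Qed.

Lemma D_addN : left_inverse D_zero D_opp D_add.
Proof.
move=> [a b]; rewrite /D_add /D_opp /D_zero /=; congr pair; first exact: addNr.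
by case: (Z2_cases a) => ->; rewrite /= ?expr0 ?expr1 ?mul1r ?mulN1r ?opprK addNr.
Qed.

HB.instance Definition _ := Finite_isGroup.Build D D_addA D_add0 D_addN.

(* Groups are finGroupTypes, hence multiplicative: the difference x - y is
   x * y^-1 and the left coset g + J is g *: J. The ambient group is the whole
   type, and a family of blocks is a sequence, read up to order. *)
Section DifferenceFamilies.

Variable gT : finGroupType.
Implicit Types (H J : {group gT}) (F : seq {set gT}).

Definition differences F : seq gT :=
  flatten [seq [seq xy.1 * xy.2^-1 | xy <- enum (setX B B) & xy.1 != xy.2]
          | B : {set gT} <- F].

(* (gT, H, 3, 1) difference family *)
Definition difference_family H F : Prop :=
  {in F, forall B : {set gT}, #|B| = 3%N} /\
  perm_eq (differences F) (enum (~: H)).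

Definition block_union F : seq gT := flatten [seq enum B | B : {set gT} <- F].

Definition resolvable H J F : Prop :=
  perm_eq [seq g *: J | g <- block_union F]
          (enum [set C in lcosets J [set: gT] | ~~ (C \subset H)]).

Definition strong_multiplier H F (a : {perm gT}) : Prop :=
  [/\ a \in Aut [set: gT],
      {in H, forall h, a h = h} &
      [set a @: (B : {set gT}) | B in F] = [set B in F]].

End DifferenceFamilies.

Definition DV (N : nat) : finGroupType := (D * V N)%type.

Definition Dx0 (N : nat) : {group DV N} := setX_group [set: D]%G (one_group (V N)).

(* Main.v *)
Require Import Defs.
From mathcomp Require Import all_boot all_order all_fingroup all_algebra.
From mathcomp Require Import all_solvable all_field.

Set Implicit Arguments.
Unset Strict Implicit.
Unset Printing Implicit Defensive.

Import GRing.Theory.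

(** Write W for the additive group of F_N, and let i in F_N satisfy i^2 = -1 in
every component. Multiplication by i generates a group of order 4 acting
semiregularly on W \ {0}, and it commutes with the group U of units of odd
order. If an element of U and a power of i act alike on some nonzero vector,
then, orders being coprime, that power of i is 1; hence <i> has a U-invariant
transversal M on W \ {0}. Four base blocks of
D x Z[i] are chosen such that, for every d in D, the differences with first
component d have as second components the four elements c <i>, with c = 2 or
c = 1 + i, both invertible in F_N; similarly each left coset of J in D receives
<i>. Multiplying the base blocks by the elements of M gives the family, and U
acts on it by strong multipliers. As the counts agree, it is enough to check
that every element outside H is a difference, and that every coset outside H
is met. *)

(** * Covering and counting criteria for difference families *)

Lemma perm_eq_min_size (T : eqType) (s1 s2 : seq T) :
  uniq s1 -> {subset s1 <= s2} -> size s2 <= size s1 -> perm_eq s2 s1.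
Proof.
move=> Us1 s12 le21; apply: uniq_perm => //; first exact: leq_size_uniq le21.
by have [_ eq12] := uniq_min_size Us1 s12 le21 => x; rewrite eq12.
Qed.

Section DifferenceFamilyCriteria.

Local Open Scope group_scope.

Variables (gT : finGroupType) (F : seq {set gT}).
Hypothesis cardF : {in F, forall B : {set gT}, #|B| = 3}.

Lemma mem_differences B x y :
  B \in F -> x \in B -> y \in B -> x != y -> x * y^-1 \in differences F.
Proof.
move=> FB Bx By x'y; apply/flatten_mapP; exists B => //.
apply/mapP; exists (x, y) => //.
by rewrite mem_filter x'y mem_enum inE /= Bx By.
Qed.

Lemma size_differences : size (differences F) = (6 * size F)%N.
Proof.
rewrite /differences size_flatten /shape -map_comp sumnE big_map.
rewrite (eq_big_seq (fun=> 6)).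
  by rewrite big_const_seq count_predT iter_addn_0.
move=> B /cardF cardB /=; rewrite size_map size_filter.
(* Adding the three diagonal pairs of [setX B B] turns the claim into 9 = 6 + 3. *)
apply: (@addIn 3); rewrite -[in LHS]cardB.
have -> : #|B| = count (predC (fun xy : gT * gT => xy.1 != xy.2)) (enum (setX B B)).
  rewrite -size_filter -(card_imset (mem B) (f := fun x => (x, x)));
    last by move=> x y [].
  rewrite cardE; apply/perm_size/uniq_perm;
    [exact: enum_uniq | exact/filter_uniq/enum_uniq |].
  move=> [x y]; rewrite mem_enum mem_filter mem_enum !inE /= negbK.
  by apply/imsetP/and3P => [[z Bz [-> ->]] //|[/eqP<- Bx _]]; exists x.
by rewrite count_predC -cardE cardsX cardB.
Qed.

Lemma size_block_union : size (block_union F) = (3 * size F)%N.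
Proof.
rewrite /block_union size_flatten /shape -map_comp sumnE big_map.
rewrite (eq_big_seq (fun=> 3)).
  by rewrite big_const_seq count_predT iter_addn_0.
by move=> B /cardF cardB /=; rewrite -cardE.
Qed.

Variables (H J : {group gT}).
Hypothesis le_FH : (6 * size F <= #|~: H|)%N.

(** By [le_FH] the list of differences is no longer than the complement of [H], so covering that
    complement leaves no room for a repetition or for a difference inside [H]. *)
Lemma difference_family_min_size :
  (forall g, g \notin H -> g \in differences F) -> difference_family H F.
Proof.
move=> covF; split=> //; apply: perm_eq_min_size; first exact: enum_uniq.
  by move=> g; rewrite mem_enum inE; apply: covF.
by rewrite size_differences -cardE.
Qed.

(** Again covering suffices by size: the cosets outside [H] have two elements each and cover the
    complement of [H], so there are at least [3 * size F] of them, the number of block entries. *)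
Lemma resolvable_min_size :
    J \subset H -> #|J| = 2 ->
    (forall g, g \notin H -> exists B b, [/\ B \in F, b \in B & b \in g *: J]) ->
  resolvable H J F.
Proof.
move=> sJH oJ covF; apply: perm_eq_min_size; first exact: enum_uniq.
  move=> C; rewrite mem_enum inE => /andP[/lcosetsP[g _ ->{C}] gJ'H].
  have Hg: g \notin H.
    by apply: contra gJ'H => Hg; rewrite -(lcoset_id Hg) mulgS.
  have [B [b [FB Bb gJb]]] := covF g Hg.
  apply/mapP; exists b; last by rewrite (lcoset_eqP gJb).
  by apply/flatten_mapP; exists B; rewrite // mem_enum.
rewrite size_map size_block_union -cardE.
set P := [set C in _ | _].
suffices: (#|~: H| <= #|P| * 2)%N.
  move/(leq_trans le_FH).
  by rewrite (mulnC #|P|) -[6]/(2 * 3)%N -mulnA leq_pmul2l.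
have: (#|cover P| <= \sum_(C in P) #|C|)%N by case: (leq_card_cover P).
rewrite (eq_bigr (fun=> 2)) => [|C]; last first.
  by rewrite inE => /andP[/lcosetsP[g _ ->] _]; rewrite card_lcoset.
rewrite sum_nat_const; apply: leq_trans; apply/subset_leq_card/subsetP=> g.
rewrite inE => Hg; apply/bigcupP; exists (g *: J); last exact: lcoset_refl.
rewrite inE; apply/andP; split; first by apply/lcosetsP; exists g; rewrite ?inE.
by apply: contra Hg => /subsetP; apply; apply: lcoset_refl.
Qed.

End DifferenceFamilyCriteria.

Definition dihedral_elt (a b : nat) : D := (inZp a, inZp b).

Lemma dihedral_eltP (d : D) :
  d \in [:: dihedral_elt 0 0; dihedral_elt 0 1; dihedral_elt 0 2;
            dihedral_elt 1 0; dihedral_elt 1 1; dihedral_elt 1 2].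
Proof. by case: d => [[[|[|?]] ?] [[|[|[|?]]] ?]]. Qed.

(** * An automorphism squaring to inversion on an abelian group of odd order *)

Section QuarterTurn.

Local Open Scope group_scope.

Variables (W : finGroupType) (i : {perm W}).
Hypothesis abelW : abelian [set: W].
Hypothesis oddW : odd #|W|.
Hypothesis autW_i : i \in Aut [set: W].
Hypothesis iK : forall x, i (i x) = x^-1.

Implicit Types x y z : W.

Lemma AutT_morph (u : {perm W}) : u \in Aut [set: W] -> {morph u : x y / x * y}.
Proof. by move=> /Aut_morphic/morphicP uM x y; rewrite uM ?inE. Qed.

Lemma AutT1 (u : {perm W}) : u \in Aut [set: W] -> u 1 = 1.
Proof. by move/AutT_morph=> uM; apply: (mulIg (u 1)); rewrite -uM !mul1g. Qed.

Lemma AutTV (u : {perm W}) x : u \in Aut [set: W] -> u x^-1 = (u x)^-1.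
Proof.
by move=> Au; apply: (mulIg (u x)); rewrite -AutT_morph // !mulVg AutT1.
Qed.

Lemma mulWC x y : x * y = y * x.
Proof. by apply: (centsP abelW); rewrite inE. Qed.

Lemma square_eq1 x : x * x = 1 -> x = 1.
Proof.
move=> xx1; apply/eqP; rewrite -order_eq1 -dvdn1.
have /eqP <- : coprime #|[set: W]| 2 by rewrite coprimen2 cardsT.
by rewrite dvdn_gcd order_dvdG ?inE //= order_dvdn expgS xx1.
Qed.

Lemma turn_fix x : i x = x -> x = 1.
Proof. by move=> ix; apply: square_eq1; rewrite -{2}ix -{2}ix iK mulgV. Qed.

(** The list is the orbit of [x] under the powers of [i]. Equal neighbours would give a fixed point
    of [i], equal opposite entries an element that is its own inverse; odd order excludes both. *)
Lemma turn_uniq x : x != 1 -> uniq [:: x; i x; x^-1; (i x)^-1].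
Proof.
move=> x_neq1.
have x_i y : y != 1 -> y != i y.
  by apply: contraNneq => eq_y; apply/eqP/turn_fix.
have x_V y : y != 1 -> y != y^-1.
  by apply: contraNneq => eq_y; apply/eqP/square_eq1; rewrite {2}eq_y mulgV.
have ix_neq1 : i x != 1.
  by apply: contra x_neq1 => /eqP ix1; rewrite -eq_invg1 -iK ix1 AutT1.
have := x_i (i x); rewrite iK => /(_ ix_neq1) x2.
have := x_i x^-1; rewrite AutTV // eq_invg1 => /(_ x_neq1) x3.
have := x_i (i x)^-1; rewrite AutTV // iK invgK eq_invg1 => /(_ ix_neq1) x4.
rewrite /= !inE !negb_or x_i // (x_V x) // (x_V (i x)) //.
by rewrite x2 x3 (eq_sym x) x4.
Qed.

(** Used to invert the scalars 2 and 1 + i, which in multiplicative notation are the maps to [x * x]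
    and [x * i x]. *)
Lemma morph_inj_surj (f : W -> W) :
  {morph f : x y / x * y} -> (forall x, f x = 1 -> x = 1) ->
  forall y, exists x, y = f x.
Proof.
move=> fM f1; have f_inj : injective f.
  move=> x y eq_f; apply: (mulIg y^-1); rewrite mulgV; apply: f1.
  by rewrite fM eq_f -fM mulgV; apply: (mulIg (f 1)); rewrite -fM !mul1g.
by move=> y; have [g _ gK] := injF_bij f_inj; exists (g y).
Qed.

Lemma square_surj y : exists x, y = x * x.
Proof.
apply: (@morph_inj_surj (fun x => x * x)); last exact: square_eq1.
by move=> x z; rewrite !mulgA -(mulgA x z) (mulWC z x) mulgA.
Qed.

Lemma mul_turn_surj y : exists x, y = x * i x.
Proof.
apply: (@morph_inj_surj (fun x => x * i x)) => [x z | x /(canRL (mulgK _))].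
  by rewrite AutT_morph // !mulgA -(mulgA x z) (mulWC z (i x)) mulgA.
(* If [x * i x = 1], then [i x = x^-1 = i (i x)], so [x] is fixed by [i]. *)
rewrite mul1g => eqx; apply/turn_fix/(@perm_inj _ i).
by rewrite iK {1}eqx invgK.
Qed.

Lemma turnX4 : i ^+ 4 = 1.
Proof. by apply/permP=> x; rewrite !permX /= !iK invgK perm1. Qed.

Lemma turnX_fix x k : x != 1 -> (i ^+ k) x = x -> (4 %| k)%N.
Proof.
move=> x_neq1; rewrite {1}(divn_eq k 4) expgD mulnC expgM turnX4 expg1n mul1g.
rewrite /dvdn; have: (k %% 4 < 4)%N by rewrite ltn_mod.
have := turn_uniq x_neq1; rewrite /= !inE !negb_or => /andP[/and3P[]].
case: (k %% 4)%N => [|[|[|[|?]]]] // x1 x2 x3 _ _; rewrite permX /= ?iK => eqx;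
  by rewrite eqx eqxx in x1 x2 x3.
Qed.

Variable U : {group {perm W}}.
Hypothesis autW_U : U \subset Aut [set: W].
Hypothesis oddU : odd #|U|.
Hypothesis centU : U \subset 'C[i].

Lemma perm_turnC u k x : u \in U -> u ((i ^+ k) x) = (i ^+ k) (u x).
Proof.
move=> Uu; rewrite -!permM; congr (fun_of_perm _ x); apply/esym/commuteX.
by apply/cent1P; apply: (subsetP centU).
Qed.

(* [u] has odd order while [<i>] is a 2-group acting semiregularly. *)
Lemma perm_turn_fix u k x :
  u \in U -> x != 1 -> u x = (i ^+ k) x -> (4 %| k)%N.
Proof.
move=> Uu x_neq1 eq_ux.
have uXx n : (u ^+ n) x = (i ^+ (k * n)) x.
  elim: n => [|n IHn]; first by rewrite muln0.
  by rewrite expgSr permM IHn perm_turnC // eq_ux -permM -expgD mulnS addnC.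
have := uXx #|U|; rewrite (expg_cardG Uu) perm1 => /esym /turnX_fix.
by move=> /(_ x_neq1); rewrite Gauss_dvdl // (@coprimeXl 2 2 _) // coprime2n.
Qed.

(** A transversal [T] of the orbits of [U * <[i]>] is spread out by [U]. Disjointness of the sets of
    turns of the elements of [M] is recorded as the bound on [#|M|], which is the form that the
    counting criteria need. *)
Lemma turn_transversal :
  exists M : {set W},
    [/\ 1 \notin M, {in U & M, forall (u : {perm W}) m, u m \in M},
        forall x, x != 1 ->
          exists2 m, m \in M & x \in [:: m; i m; m^-1; (i m)^-1] &
        (4 * #|M| <= #|W|.-1)%N].
Proof.
pose G := (U <*> <[i]>)%G; pose S := [set~ (1 : W)].
have autG : G \subset Aut [set: W] by rewrite join_subG autW_U cycle_subG.
have GE : G = U * <[i]> :> {set _}.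
  by apply: cent_joinEr; rewrite centsC cent_cycle.
have actsG : [acts G, on S | 'P].
  apply/subsetP=> a Ga; rewrite !inE; apply/subsetP=> x; rewrite !inE.
  apply: contra => /eqP.
  by rewrite /= apermE -{1}(AutT1 (subsetP autG a Ga)) => /perm_inj->.
have [_ sTS eqT covT] := orbit_transversalP actsG.
set T := orbit_transversal _ _ _ in sTS eqT covT.
pose M := [set (u : {perm W}) t | u in U, t in T].
have M1 : 1 \notin M.
  apply/imset2P=> [[u t Uu Tt]].
  rewrite -{1}(AutT1 (subsetP autW_U u Uu)) => /perm_inj t1.
  by have := subsetP sTS t Tt; rewrite !inE -t1 eqxx.
exists M; split=> // [u m Uu /imset2P[v t Uv Tt ->] | x x_neq1 |].
- by rewrite -permM; apply/imset2P; exists (v * u) t; rewrite // groupM.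
- have [|a Ga Ta] := covT x; first by rewrite !inE.
  have: a^-1 \in U * <[i]> by rewrite -GE groupV.
  (* Products of permutations act from left to right: with [a^-1 = u * i ^+ k], the vector [x] is
     the k-th turn of [u (a x)], where [a x] lies in [T]. *)
  case/mulsgP=> u _ Uu /cycleP[k ->] eq_a.
  exists (u (a x)); first by apply/imset2P; exists u (a x).
  set y := u (a x); have ->: x = (i ^+ k) y by rewrite -(permM u) -eq_a permK.
  rewrite (divn_eq k 4) expgD mulnC expgM turnX4 expg1n mul1g.
  have: (k %% 4 < 4)%N by rewrite ltn_mod.
  by case: (k %% 4)%N => [|[|[|[|?]]]] // _; rewrite permX /= ?iK !inE eqxx ?orbT.
pose h (km : 'I_4 * W) := (i ^+ km.1) km.2.
have h_inj : {in setX [set: 'I_4] M &, injective h}.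
  move=> [k m] [k' m'] /setXP[_ /imset2P[u t Uu Tt /= ->]].
  move=> /setXP[_ /imset2P[u' t' Uu' Tt' /= ->]].
  rewrite /h /= => eq_h.
  (* Equal images put [t] and [t'] in one orbit of [G], and [T] meets each orbit once. *)
  have eq_tt' : t = t'.
    apply/eqP; rewrite -eqT //; apply/orbitP.
    exists (u * i ^+ k * (u' * i ^+ k')^-1); last first.
      by rewrite /= apermE permM (permM u) eq_h -(permM u') permK.
    have [GU Gi] : {subset U <= G} /\ i \in G.
      by split; [apply/subsetP/joing_subl | rewrite -cycle_subG joing_subr].
    by rewrite groupM ?groupV // groupM ?groupX ?(GU u) ?(GU u').
  rewrite -{}eq_tt' {t' Tt'} in eq_h *.
  suffices eqk : k = k' by rewrite eqk in eq_h *; rewrite (perm_inj eq_h).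
  (* The exponent [k + (4 - k')] replaces [k - k'], which truncates in [nat]. It lies between 1 and
     7, so divisibility by 4 forces [k = k']. *)
  have eq_u : u' t = u ((i ^+ (k + (4 - k'))) t).
    rewrite perm_turnC // expgD permM eq_h -permM -expgD.
    by rewrite subnKC ?turnX4 ?perm1 // ltnW.
  have t_neq1 : t != 1 by have := subsetP sTS t Tt; rewrite !inE.
  have: (4 %| k + (4 - k'))%N.
    apply: (@perm_turn_fix (u' * u^-1) _ t); rewrite ?groupM ?groupV //.
    by rewrite permM eq_u permK.
  case: k k' {eq_h eq_u} => [[|[|[|[|?]]]] ?] [[|[|[|[|?]]]] ?] //= _;
    exact: val_inj.
have := card_in_imset h_inj; rewrite cardsX cardsT card_ord => <-.
rewrite -(cardsT W) (cardsD1 1 [set: W]) inE /=.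
apply/subset_leq_card/subsetP=> _ /imsetP[[k m] /setXP[_ Mm] ->].
rewrite !inE andbT /h /=; apply: contra M1 => /eqP.
have Ak : i ^+ k \in Aut [set: W] by rewrite groupX.
by rewrite -{1}(AutT1 Ak) => /perm_inj <-.
Qed.

(** * The base blocks, their differences and their cosets *)

Local Notation dd := dihedral_elt.
Local Notation gT := (D * W)%type.

(* With [m] for 1 and [i m] for i, the blocks come from a computer search. *)
Definition base_block (k : nat) (m : W) : {set gT} :=
  nth set0 [:: [set (dd 0 0, m); (dd 0 1, i m); (dd 0 0, m^-1)];
               [set (dd 0 1, m); (dd 0 0, i m); (dd 1 2, (i m)^-1)];
               [set (dd 0 2, m); (dd 1 1, m^-1); (dd 0 0, (i m)^-1)];
               [set (dd 0 2, i m); (dd 1 2, m^-1); (dd 0 2, (i m)^-1)]] k.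

Lemma card_base_block k m : m != 1 -> (k < 4)%N -> #|base_block k m| = 3.
Proof.
have card3 (d e f : D) (x y z : W) :
    x != y -> x != z -> y != z -> #|[set (d, x); (e, y); (f, z)]| = 3.
  move=> xy xz yz; rewrite setUC cardsU1 cards2 !inE -!pair_eqE /pair_eq /=.
  by rewrite (negPf xy) ![z == _]eq_sym (negPf xz) (negPf yz) !andbF.
move=> /turn_uniq; rewrite /= !inE !negb_or.
case/and4P=> /and3P[m1 m2 m3] /andP[m4 m5] m6 _.
by case: k => [|[|[|[|?]]]] // _; apply: card3; rewrite // eq_sym.
Qed.

(** Discharges the six premises of the local [cover] below. The quotient in [D] is computed; the one
    in [W] needs at most one commutation. *)
Ltac cover_by cover iV iK mulWC k d1 d2 x y :=
  apply: (cover k d1 d2 x y);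
    [ by [] | by rewrite !inE eqxx ?orbT | by rewrite !inE eqxx ?orbT
    | by first [done | rewrite eq_sym] | by apply/eqP; vm_compute
    | by rewrite ?iV ?iK ?invgK // mulWC ].

(** The four blocks have 24 ordered pairs of distinct entries, matching the six values of [d] times
    the four values of [z]. Each case names the block and the pair that yield the difference. *)
Lemma base_block_differences (F : seq {set gT}) m (d : D) z :
    m != 1 -> (forall k, (k < 4)%N -> base_block k m \in F) ->
    z \in [:: m; i m; m^-1; (i m)^-1] ->
  (d, if (d == dd 0 0) || (d == dd 1 2) then z * z else z * i z)
    \in differences F.
Proof.
move=> m_neq1 Fm z_m.
have cover k (d1 d2 : D) (x y w : W) :
    (k < 4)%N -> (d1, x) \in base_block k m -> (d2, y) \in base_block k m ->
  x != y -> d1 * d2^-1 = d -> w = x * y^-1 -> (d, w) \in differences F.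
  move=> /Fm FB Bx By x'y <- ->.
  apply: (mem_differences (x := (d1, x)) (y := (d2, y)) FB) => //.
  by rewrite -pair_eqE /pair_eq /= negb_and x'y orbT.
have := turn_uniq m_neq1; rewrite /= !inE !negb_or.
case/and4P=> /and3P[m1 m2 m3] /andP[m4 m5] m6 _.
have iV x : i x^-1 = (i x)^-1 by apply: AutTV.
rewrite !inE in z_m.
have := dihedral_eltP d; rewrite !inE.
case/or4P=> [/eqP d_eq|/eqP d_eq|/eqP d_eq|/or3P[]/eqP d_eq];
  rewrite {}d_eq in cover *.
- rewrite (_ : _ || _ = true); last by vm_compute.
  case/or4P: z_m => /eqP->;
    [ cover_by cover iV iK mulWC 0 (dd 0 0) (dd 0 0) m m^-1
    | cover_by cover iV iK mulWC 3 (dd 0 2) (dd 0 2) (i m) (i m)^-1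
    | cover_by cover iV iK mulWC 0 (dd 0 0) (dd 0 0) m^-1 m
    | cover_by cover iV iK mulWC 3 (dd 0 2) (dd 0 2) (i m)^-1 (i m) ].
- rewrite (_ : _ || _ = false); last by vm_compute.
  case/or4P: z_m => /eqP->;
    [ cover_by cover iV iK mulWC 0 (dd 0 1) (dd 0 0) (i m) m^-1
    | cover_by cover iV iK mulWC 0 (dd 0 1) (dd 0 0) (i m) m
    | cover_by cover iV iK mulWC 2 (dd 0 0) (dd 0 2) (i m)^-1 m
    | cover_by cover iV iK mulWC 1%N (dd 0 1) (dd 0 0) m (i m) ].
- rewrite (_ : _ || _ = false); last by vm_compute.
  case/or4P: z_m => /eqP->;
    [ cover_by cover iV iK mulWC 2 (dd 0 2) (dd 0 0) m (i m)^-1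
    | cover_by cover iV iK mulWC 1%N (dd 0 0) (dd 0 1) (i m) m
    | cover_by cover iV iK mulWC 0 (dd 0 0) (dd 0 1) m^-1 (i m)
    | cover_by cover iV iK mulWC 0 (dd 0 0) (dd 0 1) m (i m) ].
- rewrite (_ : _ || _ = false); last by vm_compute.
  case/or4P: z_m => /eqP->;
    [ cover_by cover iV iK mulWC 3 (dd 0 2) (dd 1 2) (i m) m^-1
    | cover_by cover iV iK mulWC 3 (dd 1 2) (dd 0 2) m^-1 (i m)^-1
    | cover_by cover iV iK mulWC 3 (dd 1 2) (dd 0 2) m^-1 (i m)
    | cover_by cover iV iK mulWC 3 (dd 0 2) (dd 1 2) (i m)^-1 m^-1 ].
- rewrite (_ : _ || _ = false); last by vm_compute.
  case/or4P: z_m => /eqP->;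
    [ cover_by cover iV iK mulWC 1%N (dd 0 1) (dd 1 2) m (i m)^-1
    | cover_by cover iV iK mulWC 2 (dd 1 1) (dd 0 0) m^-1 (i m)^-1
    | cover_by cover iV iK mulWC 1%N (dd 1 2) (dd 0 1) (i m)^-1 m
    | cover_by cover iV iK mulWC 2 (dd 0 0) (dd 1 1) (i m)^-1 m^-1 ].
- rewrite (_ : _ || _ = true); last by vm_compute.
  case/or4P: z_m => /eqP->;
    [ cover_by cover iV iK mulWC 2 (dd 0 2) (dd 1 1) m m^-1
    | cover_by cover iV iK mulWC 1%N (dd 0 0) (dd 1 2) (i m) (i m)^-1
    | cover_by cover iV iK mulWC 2 (dd 1 1) (dd 0 2) m^-1 m
    | cover_by cover iV iK mulWC 1%N (dd 1 2) (dd 0 0) (i m)^-1 (i m) ].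
Qed.

(** The twelve block entries match the three left cosets of the subgroup generated by [dd 1 0],
    times the four values of [z]. *)
Lemma base_block_cosets m (d : D) z :
    z \in [:: m; i m; m^-1; (i m)^-1] ->
  exists k e,
    [/\ (k < 4)%N, (e, z) \in base_block k m & e \in [:: d; d * dd 1 0]].
Proof.
rewrite !inE => z_m.
have cover k e : (k < 4)%N -> (e, z) \in base_block k m ->
    e \in [:: d; d * dd 1 0] ->
  exists k e,
    [/\ (k < 4)%N, (e, z) \in base_block k m & e \in [:: d; d * dd 1 0]].
  by move=> *; exists k, e.
have := dihedral_eltP d; rewrite !inE.
case/or4P=> [/eqP d_eq|/eqP d_eq|/eqP d_eq|/or3P[]/eqP d_eq];
  rewrite {}d_eq in cover *; move: cover; case/or4P: z_m => /eqP-> cover.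
(* Two lines for each [d], each group running through the four values of [z]. The cosets pair 00
   with 10, 01 with 12 and 02 with 11, so every choice occurs twice. *)
all: [> apply: (cover 0 (dd 0 0)) | apply: (cover 1%N (dd 0 0))
      | apply: (cover 0 (dd 0 0)) | apply: (cover 2 (dd 0 0))
      | apply: (cover 1%N (dd 0 1)) | apply: (cover 0 (dd 0 1))
      | apply: (cover 3 (dd 1 2)) | apply: (cover 1%N (dd 1 2))
      | apply: (cover 2 (dd 0 2)) | apply: (cover 3 (dd 0 2))
      | apply: (cover 2 (dd 1 1)) | apply: (cover 3 (dd 0 2))
      | apply: (cover 0 (dd 0 0)) | apply: (cover 1%N (dd 0 0))
      | apply: (cover 0 (dd 0 0)) | apply: (cover 2 (dd 0 0))
      | apply: (cover 2 (dd 0 2)) | apply: (cover 3 (dd 0 2))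
      | apply: (cover 2 (dd 1 1)) | apply: (cover 3 (dd 0 2))
      | apply: (cover 1%N (dd 0 1)) | apply: (cover 0 (dd 0 1))
      | apply: (cover 3 (dd 1 2)) | apply: (cover 1%N (dd 1 2))].
all: by [rewrite !inE eqxx ?orbT | vm_compute].
Qed.

(** * Lifting [U] to the product and assembling the family *)

Lemma prod_perm_inj (u : {perm W}) : injective (fun x : gT => (x.1, u x.2)).
Proof. by move=> [d x] [e y] [-> /perm_inj ->]. Qed.

Definition prod_perm (u : {perm W}) : {perm gT} := perm (@prod_perm_inj u).

Lemma prod_permE u (d : D) x : prod_perm u (d, x) = (d, u x).
Proof. by rewrite permE. Qed.

Lemma prod_permM : {in U &, {morph prod_perm : u v / u * v}}.
Proof.
by move=> u v _ _; apply/permP=> [[d x]]; rewrite permM !prod_permE permM.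
Qed.

Canonical prod_perm_morphism := Morphism prod_permM.

Lemma injm_prod_perm : 'injm prod_perm_morphism.
Proof.
apply/injmP=> u v _ _ eq_uv; apply/permP=> x.
by have /permP/(_ (1, x)) := eq_uv; rewrite !prod_permE => [[]].
Qed.

Lemma prod_perm_Aut u : u \in U -> prod_perm u \in Aut [set: gT].
Proof.
move=> Uu; rewrite inE; apply/andP; split; first by apply/subsetP=> x; rewrite inE.
apply/morphicP=> [[d x] [e y]] _ _; rewrite -[(d, x) * _]/(d * e, x * y) !prod_permE.
by rewrite AutT_morph // (subsetP autW_U).
Qed.

(** Block entries are built from [m] by [i] and inversion only, and [u] commutes with both. *)
Lemma prod_perm_base_block u k m :
  u \in U -> (k < 4)%N -> prod_perm u @: base_block k m = base_block k (u m).
Proof.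
move=> Uu lt_k4; have uV x : u x^-1 = (u x)^-1 by apply/AutTV/(subsetP autW_U).
have ui x : u (i x) = i (u x) by have := perm_turnC 1 x Uu.
case: k lt_k4 => [|[|[|[|?]]]] // _;
  by rewrite /base_block /= !imsetU !imset_set1 !prod_permE ?uV ?ui.
Qed.

Theorem quarter_turn_family (H := setX_group [set: D]%G (one_group W)) :
  exists (J : {group gT}) (F : seq {set gT}),
    [/\ J \subset H, #|J| = 2, difference_family H F, resolvable H J F &
        exists A : {group {perm gT}},
          (forall a, a \in A -> strong_multiplier H F a) /\ #|A| = #|U|].
Proof.
have [M [M1 UM covM leM]] := turn_transversal.
have M_neq1 m : m \in M -> m != 1 by apply: contraTneq => ->.
pose F := [seq base_block k m | k <- iota 0 4, m <- enum M].
have FB k m : (k < 4)%N -> m \in M -> base_block k m \in F.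
  by move=> lt_k4 Mm; apply: allpairs_f; rewrite ?mem_iota ?mem_enum.
have FP B : B \in F -> exists k m, [/\ (k < 4)%N, m \in M & B = base_block k m].
  case/allpairsP=> [[k m]]; rewrite mem_iota mem_enum => [[? ? ->]].
  by exists k, m.
have notH (d : D) x : ((d, x) \notin H) = (x != 1) by rewrite !inE.
have cardF : {in F, forall B : {set gT}, #|B| = 3}.
  by move=> B /FP[k [m [lt_k4 Mm ->]]]; apply/card_base_block/lt_k4/M_neq1.
(* With [4 * #|M| <= #|W|.-1], the 24 differences for each [m] number at most [6 * #|W| - 6] in
   all. *)
have le_FH : (6 * size F <= #|~: H|)%N.
  have cardH : #|H| = 6 by rewrite cardsX cards1 cardsT card_prod !card_ord.
  have cardG : #|{: gT}| = (6 * #|W|)%N by rewrite card_prod card_prod !card_ord.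
  have W_gt0 : (0 < #|W|)%N by rewrite -cardsT cardG_gt0.
  rewrite -(leq_add2l #|H|) cardsC cardH cardG.
  rewrite size_allpairs size_iota -cardE.
  by rewrite -[X in (_ <= _ * X)%N](prednK W_gt0) mulnS leq_add2l leq_mul2l leM.
pose j : gT := (dd 1 0, 1).
have oj : #[j] = 2.
  have jj : j ^+ 2 = 1.
    rewrite expgS expg1; congr pair; rewrite /= ?mulg1 //.
    by apply/eqP; vm_compute.
  by apply: nt_prime_order jj _ => //; apply/eqP => [[]]; apply/eqP; vm_compute.
have sjH : <[j]> \subset H by rewrite cycle_subG !inE eqxx.
exists <[j]>%G, F; split=> //.
- apply: difference_family_min_size => // [[d w]]; rewrite notH => w_neq1.
  (* Divide [w] by the scalar attached to [d], 2 or 1 + i; the quotient [z] is then a turn of some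
     [m] in [M]. *)
  have [z w_z] : exists z,
    w = if (d == dd 0 0) || (d == dd 1 2) then z * z else z * i z.
    by case: (_ || _); [apply: square_surj | apply: mul_turn_surj].
  have /covM[m Mm z_m] : z != 1.
    by apply: contra w_neq1 => /eqP z1; rewrite w_z z1 AutT1 // mulg1 if_same.
  rewrite w_z; apply: base_block_differences z_m; first exact: M_neq1.
  by move=> k lt_k4; apply: FB.
- apply: resolvable_min_size => // [[d w]].
  rewrite notH => /covM[m Mm /base_block_cosets].
  case/(_ d)=> k [e [lt_k4 Be de]]; exists (base_block k m), (e, w); split=> //.
    exact: FB.
  have -> : <[j]>%G = [set 1; j] :> {set gT} by apply: cycle2g.
  rewrite mem_lcoset; move: de; rewrite !inE => /orP[]/eqP->; apply/orP; [left | right].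
    by rewrite mulVg.
  by apply/eqP; congr pair; rewrite ?mulKg ?mulVg.
have imF a : a \in prod_perm_morphism @* U -> forall B, B \in F -> a @: B \in F.
  case/morphimP=> u Uu _ -> B /FP[k [m [lt_k4 Mm ->]]].
  by rewrite prod_perm_base_block //; apply/FB/UM.
exists (prod_perm_morphism @* U)%G; split; last by rewrite card_injm ?injm_prod_perm.
move=> a Aa; split.
- by case/morphimP: Aa => u Uu _ ->; apply: prod_perm_Aut.
- case/morphimP: Aa => u Uu _ -> [d x].
  rewrite -[_ \in _]negbK notH negbK => /eqP->.
  by rewrite prod_permE (AutT1 (subsetP autW_U u Uu)).
apply/setP=> B; rewrite inE; apply/imsetP/idP => [[C FC ->] | FB'].
  exact: imF.
(* The inverse of [a] is again in the group, so it also maps blocks to blocks. *)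
exists (a^-1 @: B); first by apply: imF; rewrite ?groupV.
by rewrite -imset_comp -[LHS]imset_id; apply: eq_imset => x /=; rewrite permKV.
Qed.

End QuarterTurn.

(** * Odd parts and square roots of -1 in finite fields *)

Lemma greatest_odd_divisorE m : 0 < m -> greatest_odd_divisor m = m`_2^'.
Proof.
move=> m_gt0; rewrite /greatest_odd_divisor; apply/eqP.
rewrite eqn_leq; apply/andP; split.
  apply/bigmax_leqP_seq => d; rewrite -dvdn_divisors // => d_m odd_d.
  apply: dvdn_leq; first exact: part_gt0.
  rewrite -(@part_pnat_id 2^' d) ?partn_dvd //.
  by rewrite -odd_2'nat.
apply: leq_bigmax_seq => //; first by rewrite -dvdn_divisors ?dvdn_part.
by rewrite odd_2'nat part_pnat.
Qed.

(** The unit group is cyclic of order divisible by 4, so it has an element [a] of order 4; its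
    square is a root of 1 other than 1, hence -1. *)
Lemma finField_sqrtN1 (K : finFieldType) :
  #|K| = 1 %[mod 4] -> exists a : {unit K}, (val a ^+ 2 = -1)%R.
Proof.
move=> K1; have /cyclicP[g defG] := field_unit_group_cyclic [set: {unit K}]%G.
have K_gt1 : 1 < #|K| := finNzRing_gt1 K.
have og : #[g]%g = #|K|.-1 by rewrite orderE -defG card_finField_unit.
have n_gt0 : 0 < #[g]%g := order_gt0 g.
have dv4 : 4 %| #[g]%g.
  by rewrite og -subn1 -eqn_mod_dvd ?K1 // ltnW.
pose a := (g ^+ (#[g] %/ 4))%g; exists a.
have a4 : (a ^+ 4 = 1)%g by rewrite -expgM divnK // expg_order.
have a2 : (a ^+ 2 != 1)%g.
  rewrite -expgM -order_dvdn gtnNdvd //.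
    by rewrite muln_gt0 divn_gt0 // dvdn_leq.
  by rewrite -[X in _ < X](divnK dv4) ltn_pmul2l // divn_gt0 // dvdn_leq.
have /eqP : ((val a ^+ 2) ^+ 2 = 1)%R.
  by rewrite -exprM -FinRing.val_unitX a4 FinRing.val_unit1.
rewrite sqrf_eq1 => /orP[|/eqP//].
by rewrite -FinRing.val_unitX -FinRing.val_unit1 (inj_eq val_inj) (negPf a2).
Qed.

Lemma card_dffun (I : finType) (T : I -> finType) :
  #|{: {dffun forall p, T p}}| = \prod_p #|{: T p}|.
Proof. by rewrite card_dep_ffun foldrE big_image. Qed.

(** * Units of a product of fields acting by scaling *)

Section ProductOfFields.

Variables (I : finType) (K : I -> finFieldType).

Definition field_prod : finGroupType := {dffun forall p, (K p : finGroupType)}.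
Definition unit_prod : finGroupType := {dffun forall p, {unit (K p)}}.

Implicit Types (u v : unit_prod) (x y : field_prod).

Definition scale u x : field_prod := [ffun p => val (u p) * x p : K p]%R.

Lemma scale_inj u : injective (scale u).
Proof.
move=> x y /ffunP eq_xy; apply/ffunP=> p; have := eq_xy p; rewrite !ffunE.
by apply: mulrI; apply: (valP (u p)).
Qed.

Definition scale_perm u : {perm field_prod} := perm (@scale_inj u).

Lemma scale_permE u x p : scale_perm u x p = (val (u p) * x p)%R.
Proof. by rewrite permE ffunE. Qed.

Lemma scale_permM :
  {in [set: unit_prod] &, {morph scale_perm : u v / (u * v)%g}}.
Proof.
move=> u v _ _; apply/permP=> x; rewrite permM; apply/ffunP=> p.
by rewrite !scale_permE ffunE mulrCA mulrA.
Qed.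

Canonical scale_perm_morphism := Morphism scale_permM.

Lemma injm_scale_perm : ('injm scale_perm_morphism)%g.
Proof.
apply/injmP=> u v _ _ eq_uv; apply/ffunP=> p; apply: val_inj.
(* The all-ones vector recovers [u] from its action. *)
have := scale_permE u [ffun p => 1%R : K p] p.
by rewrite /= eq_uv scale_permE !ffunE !mulr1.
Qed.

Lemma scale_perm_Aut u : scale_perm u \in Aut [set: field_prod].
Proof.
rewrite inE; apply/andP; split; first by apply/subsetP=> x; rewrite inE.
apply/morphicP=> x y _ _; apply/ffunP=> p.
(* The group law of [field_prod] is componentwise addition, so multiplicativity of the permutation
   is distributivity. *)
by rewrite scale_permE !ffunE !scale_permE; apply: mulrDr.
Qed.

Lemma unit_prod_abelian : abelian [set: unit_prod].
Proof.
by apply/centsP=> u _ v _; apply/ffunP=> p; rewrite !ffunE; apply/val_inj/mulrC.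
Qed.

Lemma card_unit_prod : #|{: unit_prod}| = \prod_p (#|K p| - 1).
Proof.
rewrite card_dffun; apply: eq_bigr => p _.
by rewrite -cardsT card_finField_unit subn1.
Qed.

Hypothesis K_mod4 : forall p, #|K p| = 1 %[mod 4].

Theorem field_prod_family (H := setX_group [set: D]%G (one_group field_prod)) :
  exists (J : {group (D * field_prod)%type})
         (F : seq {set (D * field_prod)%type}),
    [/\ J \subset H, #|J| = 2, difference_family H F, resolvable H J F &
        exists A : {group {perm (D * field_prod)%type}},
          (forall a, a \in A -> strong_multiplier H F a) /\
          #|A| = greatest_odd_divisor (\prod_p (#|K p| - 1))].
Proof.
have [a a2] := fin_all_exists (fun p => finField_sqrtN1 (K_mod4 p)).
pose i := scale_perm (finfun a).
(* The unit group is abelian, hence nilpotent, so its 2'-core is a Hall subgroup, of order the full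
   odd part. *)
pose O := 'O_2^'([set: unit_prod])%G.
have cardO : #|O| = greatest_odd_divisor (\prod_p (#|K p| - 1)).
  rewrite greatest_odd_divisorE -card_unit_prod -cardsT ?cardG_gt0 //.
  exact: card_Hall (nilpotent_pcore_Hall _ (abelian_nil unit_prod_abelian)).
have cardU : #|(scale_perm_morphism @* O)%g| = #|O|.
  by rewrite card_injm ?injm_scale_perm ?subsetT.
rewrite -cardO -cardU; apply: (@quarter_turn_family _ i).
- by apply/centsP=> x _ y _; apply/ffunP=> p; rewrite !ffunE; apply: addrC.
- rewrite card_dffun; apply: (big_ind odd) => // [m n odd_m odd_n | p _].
    by rewrite oddM odd_m.
  by rewrite -(@odd_mod _ 4) // K_mod4.
- exact: scale_perm_Aut.
- move=> x; apply/ffunP=> p; rewrite !scale_permE !ffunE mulrA -expr2 a2.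
  exact: mulN1r.
- by apply/subsetP=> _ /morphimP[u _ _ ->]; apply: scale_perm_Aut.
- by rewrite odd_2'nat cardU; apply: pcore_pgroup.
apply/subsetP=> _ /morphimP[u _ _ ->]; apply/cent1P.
by rewrite /commute -!scale_permM ?inE // (centsP unit_prod_abelian) ?inE.
Qed.

End ProductOfFields.

(** * Specialisation to the components of 4n + 1 *)

Lemma prod_seq_sub (T : choiceType) (s : seq T) (f : T -> nat) :
  uniq s -> \prod_(x : seq_sub s) f (val x) = \prod_(x <- s) f x.
Proof.
move=> Us; rewrite -(big_map val xpredT f); apply/perm_big/uniq_perm => //.
  by rewrite (map_inj_uniq val_inj) index_enum_uniq.
move=> x; apply/mapP/idP=> [[y _ ->] | sx]; first exact: valP.
by exists (SeqSub sx); rewrite ?mem_index_enum.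
Qed.

Theorem theorem7p4 (n : nat) (n_gt0 : (0 < n)%N)
    (hn : forall q : nat, q \in components (4 * n + 1) -> q = 1 %[mod 4]) :
  exists (J : {group DV (4 * n + 1)}) (F : seq {set DV (4 * n + 1)}),
    [/\ J \subset Dx0 (4 * n + 1),
        #|J| = 2,
        difference_family (Dx0 (4 * n + 1)) F,
        resolvable (Dx0 (4 * n + 1)) J F &
        exists A : {group {perm DV (4 * n + 1)}},
          (forall a : {perm DV (4 * n + 1)},
             a \in A -> strong_multiplier (Dx0 (4 * n + 1)) F a) /\
          #|A| = greatest_odd_divisor (psi (4 * n + 1))].
Proof.
have -> : psi (4 * n + 1) =
    \prod_(p : seq_sub (primes (4 * n + 1))) (#|component_field p| - 1).
  under eq_bigr do rewrite card_component_field.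
  rewrite (@prod_seq_sub _ _ (fun p => p ^ logn p (4 * n + 1) - 1)) ?primes_uniq //.
  by rewrite /psi big_map.
(* [V] is convertible to [field_prod] of the component fields; only the congruence modulo 4
   remains. *)
apply: (@field_prod_family _ (@component_field (4 * n + 1))) => p.
by rewrite card_component_field; apply/hn/map_f/valP.
Qed.
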